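(* Let $n \geq 1$ and $k \geq 1$ be integers, and let $S_{0}: a_{1}, a_{2}, \dots, a_{n}$ be a graphical sequence of integers with $0 \leq a_{1} \leq a_{2} \leq \cdots \leq a_{n}$ such that there exist exactly $k$ graphs, up to isomorphism, that realize $S_{0}$. For each integer $i \geq 1$, let $S_{0}^{(i)}$ be the sequence of length $n+2i$ given by $$S_{0}^{(i)}: 1, 2, 3, \dots, i,\ a_{1}+i, a_{2}+i, \dots, a_{n}+i,\ n+i, n+i+1, \dots, n+2i-1.$$ (So, for example, $S_{0}^{(1)}: 1, a_{1}+1, \dots, a_{n}+1, n+1$ and $S_{0}^{(2)}: 1, 2, a_{1}+2, \dots, a_{n}+2, n+2, n+3$.) Then for every integer $i \geq 1$ the sequence $S_{0}^{(i)}$ is graphical, and there exist exactly $k$ connected graphs, up to isomorphism, that realize $S_{0}^{(i)}$.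
   Context: All graphs are finite and simple (no loops or multiple edges). A sequence $d_{1}, d_{2}, \dots, d_{m}$ of nonnegative integers is a degree sequence of a graph $G$ of order $m$ (and $G$ is said to realize the sequence) if the vertices of $G$ can be labeled $v_{1}, \dots, v_{m}$ so that $\deg v_{j} = d_{j}$ for $1 \leq j \leq m$. A finite sequence of nonnegative integers is graphical if some graph realizes it. Two graphs are isomorphic if there is a bijection between their vertex sets that preserves adjacency and non-adjacency. Saying there are exactly $k$ graphs up to isomorphism with a given property means that the graphs with that property form exactly $k$ isomorphism classes. *)

(* Defs.v *)
From mathcomp Require Import all_boot.

Set Implicit Arguments.
Unset Strict Implicit.
Unset Printing Implicit Defensive.

Record sgraph := SGraph {
  vertex :> finType;
  adj : rel vertex;
  adj_sym : symmetric adj;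
  adj_irrefl : irreflexive adj
}.

Definition deg (G : sgraph) (x : G) : nat := #|[set y : G | adj x y]|.

Definition isomorphic (G H : sgraph) : Prop :=
  exists2 f : G -> H, bijective f & forall x y : G, adj (f x) (f y) = adj x y.

Definition connected (G : sgraph) : Prop :=
  forall x y : G, connect (@adj G) x y.

(* [v] is the labelling of the vertices; its bijectivity forces the order of
   [G] to be the length of [s]. *)
Definition realizes (s : seq nat) (G : sgraph) : Prop :=
  exists2 v : 'I_(size s) -> G, bijective v &
    forall j : 'I_(size s), deg (v j) = nth 0 s j.

Definition graphical (s : seq nat) : Prop := exists G : sgraph, realizes s G.

(* [G] is a system of representatives of the isomorphism classes of graphs
   satisfying [P], indexed without repetition by the [k] elements of ['I_k]. *)
Definition exactly_up_to_iso (k : nat) (P : sgraph -> Prop) : Prop :=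
  exists G : 'I_k -> sgraph,
    [/\ forall j : 'I_k, P (G j),
        forall j l : 'I_k, isomorphic (G j) (G l) -> j = l
      & forall H : sgraph, P H -> exists j : 'I_k, isomorphic H (G j)].

Definition extend (i : nat) (a : seq nat) : seq nat :=
  iota 1 i ++ [seq x + i | x <- a] ++ iota (size a + i) i.

Example extend1 (x y : nat) : extend 1 [:: x; y] = [:: 1; x + 1; y + 1; 3].
Proof. by []. Qed.

Example extend2 (x y : nat) :
  extend 2 [:: x; y] = [:: 1; 2; x + 2; y + 2; 4; 5].
Proof. by []. Qed.

Lemma size_extend (i : nat) (a : seq nat) :
  size (extend i a) = size a + 2 * i.
Proof. by rewrite !size_cat !size_iota size_map addnCA addnn mul2n. Qed.

(* Main.v *)
Require Import Defs.
From mathcomp Require Import all_boot.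

(** Since [extend i.+1 a = extend 1 (extend i a)], it suffices to treat one
    extension [1, a_1 + 1, .., a_n + 1, n + 1], provided the statement inducted
    on counts all realizations.  Connectedness is then automatic: a graph
    realizing [extend i a] with [0 < i] has a vertex adjacent to all others.

    One extension is, up to order, two steps of the same shape: add an isolated
    vertex (degree sequence [0, a_1, .., a_n]), then a dominating vertex
    (degree sequence [n + 1, 1, a_1 + 1, .., a_n + 1]).  Both are the operation
    [add_vertex b], which adjoins a vertex adjacent to every old vertex when [b]
    holds and to none otherwise, and it induces a bijection between isomorphism
    classes of realizations of [s] and of the enlarged sequence [augment b s]:
    - it realizes the right sequence, and only then ([realizes_add_vertex]);
    - it is onto, because the new entry of [augment b s] is so extreme that a
      vertex of that degree is adjacent to all or to none of the others
      ([augment_uniform], [split_uniform]);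
    - it is injective on isomorphism classes, because two vertices that are both
      adjacent to everything, or both to nothing, are interchangeable
      ([add_vertex_cancel]). *)

Set Implicit Arguments.
Unset Strict Implicit.
Unset Printing Implicit Defensive.

(** * Isomorphisms *)

Lemma isomorphic_sym (G H : sgraph) : isomorphic G H -> isomorphic H G.
Proof.
case=> f [g fK gK] fA; exists g; first by exists f.
by move=> x y; rewrite -fA !gK.
Qed.

Lemma isomorphic_trans (G H K : sgraph) :
  isomorphic G H -> isomorphic H K -> isomorphic G K.
Proof.
case=> f f_bij fA [g g_bij gA]; exists (g \o f); first exact: bij_comp.
by move=> x y; rewrite /= gA fA.
Qed.

Lemma deg_isomorphism (G H : sgraph) (f : G -> H) (x : G) :
  bijective f -> (forall y z, adj (f y) (f z) = adj y z) -> deg (f x) = deg x.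
Proof.
move=> f_bij fA; rewrite /deg -(card_imset _ (bij_inj f_bij)).
case: f_bij => g fK gK; congr #|pred_of_set _|; apply/setP => y.
by rewrite -(gK y) (mem_imset _ _ (can_inj fK)) !inE fA.
Qed.

Lemma realizes_isomorphic (s : seq nat) (G H : sgraph) :
  isomorphic G H -> realizes s G -> realizes s H.
Proof.
case=> f f_bij fA [v v_bij vdeg]; exists (f \o v); first exact: bij_comp.
by move=> j; rewrite /= deg_isomorphism.
Qed.

Lemma exactly_up_to_iso_ext (k : nat) (P Q : sgraph -> Prop) :
  (forall G, P G <-> Q G) -> exactly_up_to_iso k P -> exactly_up_to_iso k Q.
Proof.
move=> PQ [G [GP Ginj Gall]]; exists G; split=> // [j|H /PQ /Gall //].
exact/PQ.
Qed.

(** * Degree sequences as multisets *)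

Definition degs (G : sgraph) : seq nat := [seq deg x | x <- enum G].

Lemma perm_map_lift (T : eqType) (f : T -> nat) (s : seq nat) (t : seq T) :
  perm_eq s (map f t) -> exists2 t', perm_eq t' t & s = map f t'.
Proof.
elim: s t => [|d s IHs] t st.
  by exists [::] => //; case: t st => // x t /perm_size.
have /mapP[x xt dE] : d \in map f t by rewrite -(perm_mem st) mem_head.
have tE := perm_to_rem xt.
have := perm_trans st (perm_map f tE); rewrite dE /= perm_cons => /IHs.
case=> t' t't ->; exists (x :: t') => //.
by rewrite perm_sym (perm_trans tE) // perm_cons perm_sym.
Qed.

(** A labelling of the vertices is the same thing as an enumeration of them;
    hence realizability only sees the sequence up to order. *)
Lemma realizesP (s : seq nat) (G : sgraph) :
  realizes s G <-> perm_eq s (degs G).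
Proof.
split=> [[v v_bij vdeg]|/perm_map_lift[t tG ->]].
  have -> : s = [seq deg x | x <- [seq v j | j <- enum 'I_(size s)]].
    rewrite -map_comp (eq_map vdeg) -[LHS](mkseq_nth 0) /mkseq -val_enum_ord.
    by rewrite -map_comp.
  apply/perm_map/uniq_perm; rewrite ?enum_uniq //.
    by rewrite map_inj_uniq ?enum_uniq //; apply: bij_inj.
  case: v_bij => w _ wK x; rewrite mem_enum -(wK x).
  by rewrite map_f // mem_enum.
have sz : size (map (@deg G) t) = size t by rewrite size_map.
exists (fun j => tnth (in_tuple t) (cast_ord sz j)).
  apply: inj_card_bij.
    move=> i j /(tuple_uniqP (in_tuple t)) eq_ij.
    apply: (cast_ord_inj (eq_n := sz)); apply: eq_ij.
    by rewrite (perm_uniq tG) enum_uniq.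
  by rewrite card_ord sz (perm_size tG) -cardE.
move=> j; rewrite (tnth_nth (tnth (in_tuple t) (cast_ord sz j))) /=.
by rewrite (nth_map (tnth (in_tuple t) (cast_ord sz j))) // -sz.
Qed.

Lemma realizes_card (s : seq nat) (G : sgraph) : realizes s G -> #|G| = size s.
Proof. by move/realizesP/perm_size->; rewrite size_map -cardE. Qed.

Lemma realizes_perm (s t : seq nat) (G : sgraph) :
  perm_eq s t -> realizes s G <-> realizes t G.
Proof.
by move=> st; split=> /realizesP sG; apply/realizesP;
  rewrite -(permPl st) in sG *.
Qed.

(** * Adding an isolated or a dominating vertex *)

Section AddVertex.
Variables (b : bool) (G : sgraph).

Definition add_vertex_adj (x y : option G) : bool :=
  match x, y with
  | Some u, Some v => adj u v
  | None, None => false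
  | _, _ => b
  end.

Lemma add_vertex_sym : symmetric add_vertex_adj.
Proof. by case=> [x|] [y|] //=; rewrite adj_sym. Qed.

Lemma add_vertex_irrefl : irreflexive add_vertex_adj.
Proof. by case=> [x|] //=; rewrite adj_irrefl. Qed.

Definition add_vertex : sgraph := SGraph add_vertex_sym add_vertex_irrefl.

Lemma card_option_set (A : {set option G}) :
  #|A| = (None \in A) + #|[set y | Some y \in A]|.
Proof.
rewrite (cardsD1 None); congr (_ + _).
rewrite -[RHS](card_imset _ Some_inj); congr #|pred_of_set _|.
apply/setP => -[y|]; rewrite !inE /=.
  by rewrite (mem_imset _ _ Some_inj) inE.
by apply/esym/imsetP => -[].
Qed.

Lemma deg_add_vertex_new : deg (None : add_vertex) = b * #|G|.
Proof.
rewrite /deg card_option_set !inE /= add0n.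
case: b; last by apply: eq_card0 => y; rewrite !inE.
by rewrite mul1n; apply: eq_card => y; rewrite !inE.
Qed.

Lemma deg_add_vertex_old (x : G) : deg (Some x : add_vertex) = deg x + b.
Proof.
rewrite /deg card_option_set !inE /= addnC; congr (_ + _).
by apply: eq_card => y; rewrite !inE.
Qed.

Lemma degs_add_vertex :
  perm_eq (degs add_vertex) (b * #|G| :: [seq d + b | d <- degs G]).
Proof.
have enumE : perm_eq (enum {: option G}) (None :: map Some (enum G)).
  apply: uniq_perm; rewrite ?enum_uniq //=.
    rewrite (map_inj_uniq Some_inj) enum_uniq andbT.
    by apply/mapP => -[].
  case=> [x|]; rewrite mem_enum !inE //=.
  by rewrite (mem_map Some_inj) mem_enum.
apply: perm_trans (perm_map _ enumE) _ => /=.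
rewrite deg_add_vertex_new perm_cons /degs -!map_comp.
by rewrite (eq_map deg_add_vertex_old).
Qed.

End AddVertex.

Definition augment (b : bool) (s : seq nat) : seq nat :=
  b * size s :: [seq d + b | d <- s].

Lemma realizes_add_vertex (b : bool) (s : seq nat) (G : sgraph) :
  realizes (augment b s) (add_vertex b G) <-> realizes s G.
Proof.
split=> sG.
  have szG : #|G| = size s.
    have := realizes_card sG; rewrite /= size_map card_option.
    by case.
  move/realizesP: sG; rewrite (permPr (degs_add_vertex b G)) szG perm_cons.
  by move/(perm_map_inj (@addIn b)) => sG; apply/realizesP.
apply/realizesP; rewrite (permPr (degs_add_vertex b G)) (realizes_card sG).
by rewrite perm_cons; apply: perm_map; apply/realizesP.
Qed.

Lemma add_vertex_isomorphic (b : bool) (G H : sgraph) :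
  isomorphic G H -> isomorphic (add_vertex b G) (add_vertex b H).
Proof.
case=> f [g fK gK] fA; exists (omap f : add_vertex b G -> add_vertex b H).
  by exists (omap g) => -[x|] //=; rewrite ?fK ?gK.
by case=> [x|] [y|] /=; rewrite ?fA.
Qed.

(** An isomorphism [f] need not match the two new vertices.  Otherwise let
    [f (Some x) = None] and [f None = Some z]: redirecting [x] to [z] repairs
    it, as adjacency of [z] to another [f (Some y)] is that of [None] to
    [Some y], namely [b], and so is adjacency of [x] to [y], read off from the
    image [None] of [Some x]. *)
Lemma add_vertex_cancel (b : bool) (G H : sgraph) :
  isomorphic (add_vertex b G) (add_vertex b H) -> isomorphic G H.
Proof.
case=> f f_bij fA; have f_inj := bij_inj f_bij.
have cardGH : #|G| = #|H|.
  by have /= := bij_eq_card f_bij; rewrite !card_option => -[].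
pose good x y := f (Some x) = Some y \/ f (Some x) = None /\ f None = Some y.
have /fin_all_exists[g gP] : forall x, exists y, good x y.
  move=> x; case Ex: (f (Some x)) => [y|]; first by exists y; left.
  case EN: (f None) => [z|]; first by exists z; right.
  by have := f_inj (Some x) None; rewrite Ex EN => /(_ erefl).
exists g.
  apply: inj_card_bij; last by rewrite cardGH.
  move=> x y gxy; have := gP y; rewrite -gxy.
  case: (gP x) => [Ex|[Ex EN]] [Ey|[Ey EN']].
  - by have /f_inj[] := etrans Ex (esym Ey).
  - by have /f_inj := etrans Ex (esym EN').
  - by have /f_inj := etrans EN (esym Ey).
  - by have /f_inj[] := etrans Ex (esym Ey).
move=> x y; have := fA (Some x) (Some y).
case: (gP x) => [Ex|[Ex EN]]; case: (gP y) => [Ey|[Ey EN']];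
  rewrite Ex Ey //= => <-.
- by have := fA (Some x) None; rewrite Ex EN'.
- by have := fA None (Some y); rewrite EN Ey.
- by move: EN'; rewrite EN => -[->]; rewrite adj_irrefl.
Qed.

(** * Recognizing an isolated or a dominating vertex *)

Section DeleteVertex.
Variables (G : sgraph) (x : G).

Definition delete_vertex : sgraph :=
  @SGraph {y : G | y != x} (fun y z => adj (val y) (val z))
    (fun y z => adj_sym (val y) (val z)) (fun y => adj_irrefl (val y)).

Lemma split_uniform (b : bool) :
  (forall y, y != x -> adj x y = b) ->
  isomorphic G (add_vertex b delete_vertex).
Proof.
move=> xb; apply: isomorphic_sym.
exists (oapp val x : add_vertex b delete_vertex -> G).
  exists insub => [[y|]|y] /=; first by rewrite valK.
    by rewrite insubF ?eqxx.
  by case: insubP => //= /negPn/eqP.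
case=> [y|] [z|] //=; rewrite ?adj_irrefl ?(xb _ (valP z)) //.
by rewrite adj_sym (xb _ (valP y)).
Qed.

End DeleteVertex.

(** The vertex labelled by the head of [augment b s] has degree [0] or [#|G|.-1],
    the two values that determine the whole neighbourhood. *)
Lemma augment_uniform (b : bool) (s : seq nat) (G : sgraph) :
  realizes (augment b s) G -> exists x : G, forall y, y != x -> adj x y = b.
Proof.
move=> sG; have := realizes_card sG; case: sG => v _ /(_ ord0) /=.
rewrite size_map; move: (v ord0) => x degx cardG {v}; exists x => y yx.
case: b degx => [|] degx; last first.
  by move/card0_eq: degx => /(_ y); rewrite !inE.
have subx : [set y | adj x y] \subset [set~ x].
  apply/subsetP => z; rewrite !inE.
  by apply: contraTneq => ->; rewrite adj_irrefl.
have : y \in [set~ x] by rewrite !inE.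
have /eqP <- : [set y | adj x y] == [set~ x]; last by rewrite inE.
by rewrite eqEcard subx cardsC1 cardG -/(deg x) degx mul1n leqnn.
Qed.

(** * Counting the realizations of an extended sequence *)

(** Adding a vertex to each graph of a system of representatives gives a system
    of representatives for [augment b s]. *)
Lemma augment_exactly (b : bool) (k : nat) (s : seq nat) :
  exactly_up_to_iso k (realizes s) ->
  exactly_up_to_iso k (realizes (augment b s)).
Proof.
case=> G [Gs Ginj Gall]; exists (fun j => add_vertex b (G j)); split.
- by move=> j; apply/realizes_add_vertex.
- by move=> j l /add_vertex_cancel /Ginj.
move=> H sH; have [x /split_uniform Hx] := augment_uniform sH.
have /realizes_add_vertex/Gall[j Gj] := realizes_isomorphic Hx sH.
by exists j; apply: isomorphic_trans Hx (add_vertex_isomorphic b Gj).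
Qed.

(** The leaf of the extension is the isolated vertex of the first step, joined to
    the dominating vertex of the second. *)
Lemma extend1_augment (s : seq nat) :
  perm_eq (augment true (augment false s)) (extend 1 s).
Proof.
rewrite /augment /extend /= mul1n size_map -map_comp.
rewrite (eq_map (g := fun d => d + 1)) => [|d]; last by rewrite /= addn0.
by rewrite mul0n -addn1 -cat_cons cats1 perm_sym perm_rcons perm_refl.
Qed.

Lemma extendS (i : nat) (s : seq nat) : extend i.+1 s = extend 1 (extend i s).
Proof.
rewrite /extend /= !map_cat !size_cat !size_iota size_map -!catA -map_comp.
have shift m : [seq x + 1 | x <- iota m i] = iota m.+1 i.
  by rewrite -(add1n m) iotaDl; apply: eq_map => x; rewrite addnC.
rewrite !shift (eq_map (g := fun x => x + i.+1)) => [|x]; last first.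
  by rewrite /= -addnA addn1.
have iota_last m : m :: iota m.+1 i = iota m i ++ [:: m + i].
  by rewrite -[RHS](iotaD m i 1) addn1.
by rewrite iota_last addnS addSn addn1 (addnC i).
Qed.

Lemma extend_exactly (k : nat) (s : seq nat) (i : nat) :
  exactly_up_to_iso k (realizes s) ->
  exactly_up_to_iso k (realizes (extend i s)).
Proof.
move=> s_k; elim: i => [|i IHi].
  by rewrite /extend cats0 (eq_map (addn0)) map_id.
rewrite extendS; apply: exactly_up_to_iso_ext.
  by move=> G; apply: realizes_perm; apply: extend1_augment.
exact/augment_exactly/augment_exactly.
Qed.

(** The last vertex added is dominating, so any two vertices are joined through
    it. *)
Lemma extend_connected (i : nat) (s : seq nat) (G : sgraph) :
  0 < i -> realizes (extend i s) G -> connected G.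
Proof.
case: i => // i _; rewrite extendS => /(realizes_perm _ (extend1_augment _)).
case/augment_uniform => x xP y z.
have xy u : connect (@adj G) x u.
  by have [->|/xP] := eqVneq u x; [exact: connect0 | exact: connect1].
by apply: connect_trans (xy z); rewrite (sym_connect_sym (@adj_sym G)).
Qed.

Theorem theorem2p1 (n k : nat) (a : seq nat)
    (n_ge1 : 1 <= n) (k_ge1 : 1 <= k)
    (size_a : size a = n) (a_sorted : sorted leq a)
    (a_graphical : graphical a)
    (a_exactly_k : exactly_up_to_iso k (realizes a)) :
  forall i : nat, 1 <= i ->
    graphical (extend i a) /\
    exactly_up_to_iso k (fun G : sgraph => connected G /\ realizes (extend i a) G).
Proof.
move=> i i_gt0; have ext_k := extend_exactly i a_exactly_k; split.
  by case: ext_k => G [Gs _ _]; exists (G (Ordinal k_ge1)).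
apply: exactly_up_to_iso_ext ext_k => G; split=> [eG|[] //].
by split=> //; apply: extend_connected eG.
Qed.
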